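(* (a) For all $n\in\mathbb{N}_0$, all real $\beta\ge 0$ and all real $\alpha\ge\beta-\lfloor\beta\rfloor$, $$\left(\frac{1+x}{2}\right)^{\beta/2}\left|P_n^{(\alpha,\beta)}(x)\right|\le\binom{n+\alpha}{n},\qquad x\in[-1,1].$$ (b) Equivalently, in terms of Meixner polynomials: for all $n\in\mathbb{N}_0$, all real $x\ge n$, all $0<c<1$ and all real $\beta\ge x-\lfloor x\rfloor+1$, $$c^{(n+x)/2}\left|M_n(x;\beta,c)\right|\le 1.$$
   Context: $\mathbb{N}_0=\{0,1,2,\dots\}$; $\lfloor\cdot\rfloor$ is the floor function. $\binom{n+\alpha}{n}=\frac{(\alpha+1)(\alpha+2)\cdots(\alpha+n)}{n!}$ (equal to $1$ for $n=0$), and $0^0=1$. The Jacobi polynomials are defined by $$P_n^{(\alpha,\beta)}(x)=\sum_{k=0}^n\binom{n+\alpha}{n-k}\binom{n+\beta}{k}\left(\frac{x-1}{2}\right)^k\left(\frac{x+1}{2}\right)^{n-k},$$ where $\binom{z}{k}=z(z-1)\cdots(z-k+1)/k!$. The Meixner polynomials are $$M_n(x;\beta,c)=\sum_{k=0}^{n}\frac{(-n)_k(-x)_k}{(\beta)_k\,k!}\,(1-c^{-1})^k,$$ where $(a)_k=a(a+1)\cdots(a+k-1)$, $(a)_0=1$. *)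

(* Defs.v *)
From mathcomp Require Import all_boot all_order all_algebra.
Set Implicit Arguments.
Unset Strict Implicit.
Unset Printing Implicit Defensive.
Import Order.TTheory GRing.Theory Num.Theory.
Local Open Scope ring_scope.

(* The binomial coefficient z (z - 1) ... (z - k + 1) / k! with a field element
   as upper argument; 'C(n, k) only covers natural upper arguments. *)
Definition gbinom (F : fieldType) (z : F) (k : nat) : F :=
  (\prod_(i < k) (z - i%:R)) / k`!%:R.

(* The shifted factorial a (a + 1) ... (a + k - 1). *)
Definition pochhammer (F : fieldType) (a : F) (k : nat) : F :=
  \prod_(i < k) (a + i%:R).

Definition jacobi (F : fieldType) (n : nat) (alpha beta x : F) : F :=
  \sum_(k < n.+1)
    gbinom (n%:R + alpha) (n - k) * gbinom (n%:R + beta) k *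
    ((x - 1) / 2) ^+ k * ((x + 1) / 2) ^+ (n - k).

Definition meixner (F : fieldType) (n : nat) (x beta c : F) : F :=
  \sum_(k < n.+1)
    pochhammer (- n%:R) k * pochhammer (- x) k /
    (pochhammer beta k * k`!%:R) * (1 - c^-1) ^+ k.

(* Main.v *)
(* Put t = (1 + x) / 2, c = t and beta_Meixner = alpha + 1: both parts become
   t^(beta/2) |Q_alpha(t)| <= 1, where Q_alpha is the Jacobi polynomial in t
   normalized by Q_alpha(1) = 1.

   Case alpha = 0, Q = Q_0.  Let M(t) = beta int_0^t s^(beta-1) Q^2 ds and
   M = t^beta Q^2 + h, so that h' = -2 t^beta Q Q' and h(0) = 0.  As Q is
   orthogonal to Q' for the weight t^beta, h(1) = 0, hence M(1) = Q(1)^2 = 1.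
   With l = n (n + beta + 1), the differential equation of Q shows that
   l h - t^(beta+1) (1 - t) Q'^2 has derivative
   t^beta Q'^2 (beta + 1 - (beta + 2) t) and vanishes at 0 and 1; it is thus
   nonnegative, so h >= 0 and t^beta Q^2 <= M(t) <= M(1) = 1.  Below,
   h = t^(beta+1) e and M = t^beta p with polynomials e and p.

   Case alpha > 0.  Euler's integral for 2F1(-n, -x; alpha + 1; 1 - 1/c)
   averages the case alpha = 0 over the law alpha (1 - s)^(alpha-1) ds of s, with
   c replaced by c_s, where 1 - 1/c_s = s (1 - 1/c) and hence c <= c_s <= 1. *)

Require Import Defs.
From mathcomp Require Import all_boot all_order all_algebra.
From mathcomp Require Import boolp classical_sets functions reals exp.
From mathcomp Require Import topology normedtype derive ring lra.
Set Implicit Arguments.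
Unset Strict Implicit.
Unset Printing Implicit Defensive.
Import Order.TTheory GRing.Theory Num.Theory.
Import numFieldNormedType.Exports.
Local Open Scope ring_scope.

(** * Monotonicity and sign of t^a e(t) from the Euler operator a e + t e' *)

(** The derivative of s^a e(s) is s^(a-1) (a e(s) + s e'(s)); conclude by the mean value theorem. *)
Lemma powR_mul_horner_le (R : realType) (a u v : R) (e : {poly R}) :
  0 < u -> u <= v ->
  (forall s : R, u <= s <= v -> 0 <= a * e.[s] + s * e^`().[s]) ->
  u `^ a * e.[u] <= v `^ a * e.[v].
Proof.
move=> u0 uv e_ge0.
pose F : R -> R := (@powR R)^~ a * horner e.
have dF (s : R) : 0 < s ->
    is_derive s 1 F (s `^ (a - 1) * (a * e.[s] + s * e^`().[s])).
  move=> s0; rewrite /F.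
  have -> : s `^ (a - 1) * (a * e.[s] + s * e^`().[s]) =
      s `^ a *: e^`().[s] + e.[s] *: (a * s `^ (a - 1)).
    have -> : s `^ a = s * s `^ (a - 1).
      rewrite -[X in _ = X * _](powRr1 (ltW s0)) -powRD ?(gt_eqF s0) ?implybT//.
      by rewrite addrC subrK.
    rewrite /GRing.scale /=; ring.
  by apply: is_deriveM; exact: is_derive1_powR.
have uvP s : s \in `[u, v] -> 0 < s.
  by rewrite in_itv/= => /andP[us _]; exact: lt_le_trans us.
have [||c] := @MVT_segment R F
  (fun s => s `^ (a - 1) * (a * e.[s] + s * e^`().[s])) u v uv.
- by move=> s /subset_itv_oo_cc /uvP; exact: dF.
- by apply: derivable_within_continuous => s /uvP /dF[].
rewrite in_itv/= => cuv Fvu; rewrite -subr_ge0.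
suff : 0 <= F v - F u by [].
by rewrite Fvu mulr_ge0 ?subr_ge0// mulr_ge0 ?powR_ge0// e_ge0.
Qed.

(** On (0, b], s^a e(s) is nondecreasing, and it tends to 0 at 0+ because a > 0. *)
Lemma euler_ge0 (R : realType) (a b : R) (e : {poly R}) :
  0 < a -> (forall s : R, 0 < s <= b -> 0 <= a * e.[s] + s * e^`().[s]) ->
  forall t : R, 0 < t <= b -> 0 <= e.[t].
Proof.
move=> a0 e_ge0 t /andP[t0 tb].
suff : 0 <= t `^ a * e.[t] by rewrite pmulr_rge0 ?powR_gt0.
apply: (@cvgr_to_le _ (at_right (0 : R)) _ R (fun s => s `^ a * e.[s])).
  have := @cvgM _ _ (at_right (0 : R)) _ _ _ _ _ (powR_cvg0 a0)
    (cvg_at_right_filter (@continuous_horner R e 0)).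
  by rewrite mul0r; exact.
near=> s; have s0 : 0 < s by [].
apply: powR_mul_horner_le => // [|r /andP[sr rt]].
  by near: s; exact: nbhs_right_ltW.
apply: e_ge0; rewrite (lt_le_trans s0 sr) (le_trans rt tb).
Unshelve. all: by end_near. Qed.

(** * Inverse of the Euler operator, and moments *)

(** X^k is an eigenvector of p |-> a p + X p' with eigenvalue a + k. For a > 0, t^a times this
    polynomial is the integral of s^(a-1) p(s) over [0, t], so no integration theory is involved. *)
Definition euler_inv (R : numFieldType) (a : R) (p : {poly R}) : {poly R} :=
  \poly_(k < size p) (p`_k / (a + k%:R)).

Lemma coef_euler_inv (R : numFieldType) (a : R) (p : {poly R}) k :
  (euler_inv a p)`_k = p`_k / (a + k%:R).
Proof.
by rewrite coef_poly; case: ltnP => // pk; rewrite [p`_k]nth_default ?mul0r.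
Qed.

Lemma euler_invK (R : numFieldType) (a : R) (p : {poly R}) : 0 < a ->
  a%:P * euler_inv a p + 'X * (euler_inv a p)^`() = p.
Proof.
move=> a0; apply/polyP => k.
rewrite coefD coefCM coefXM coef_deriv !coef_euler_inv.
have ak : a + k%:R != 0 by rewrite gt_eqF// ltr_wpDr.
case: k ak => [|k] ak /=; first by rewrite !addr0 in ak *; rewrite mulrC divfK.
by rewrite -[(_ / _) *+ k.+1]mulr_natl -mulrDl mulrC divfK.
Qed.

Lemma euler_inv_id (R : numFieldType) (a : R) (p : {poly R}) : 0 < a ->
  euler_inv a (a%:P * p + 'X * p^`()) = p.
Proof.
move=> a0; apply/polyP => k.
rewrite coef_euler_inv coefD coefCM coefXM coef_deriv.
have ak : a + k%:R != 0 by rewrite gt_eqF// ltr_wpDr.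
case: k ak => [|k] ak /=; first by rewrite !addr0 in ak *; rewrite mulrC mulKf.
by rewrite -[p`_k.+1 *+ k.+1]mulr_natl -mulrDl mulrC mulKf.
Qed.

(* [moment a p] is the integral of s^(a-1) p(s) over [0, 1]. *)
Definition moment (R : numFieldType) (a : R) (p : {poly R}) : R :=
  (euler_inv a p).[1].

Lemma momentD (R : numFieldType) (a : R) (p q : {poly R}) :
  moment a (p + q) = moment a p + moment a q.
Proof.
rewrite /moment -hornerD; congr _.[1]; apply/polyP => k.
by rewrite coefD !coef_euler_inv coefD mulrDl.
Qed.

Lemma momentZ (R : numFieldType) (a c : R) (p : {poly R}) :
  moment a (c%:P * p) = c * moment a p.
Proof.
rewrite /moment -[in RHS](hornerC c 1) -hornerM; congr _.[1]; apply/polyP => k.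
by rewrite coefCM !coef_euler_inv coefCM mulrA.
Qed.

Lemma moment_euler (R : numFieldType) (a : R) (p : {poly R}) : 0 < a ->
  moment a (a%:P * p + 'X * p^`()) = p.[1].
Proof. by move=> a0; rewrite /moment euler_inv_id. Qed.

(** * The case alpha = 0: differential equation and orthogonality *)

Definition jacobi_coef (R : numFieldType) (n : nat) (b : R) (k : nat) : R :=
  'C(n, k)%:R * gbinom (n%:R + b) k.

Lemma jacobi_coefS (R : numFieldType) (n : nat) (b : R) (k : nat) : (k <= n)%N ->
  (k.+1%:R) ^+ 2 * jacobi_coef n b k.+1 =
    (n%:R - k%:R) * (n%:R + b - k%:R) * jacobi_coef n b k.
Proof.
move=> kn; rewrite /jacobi_coef /gbinom big_ord_recr/= factS natrM.
have k0 : k.+1%:R != 0 :> R by rewrite pnatr_eq0.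
have f0 : k`!%:R != 0 :> R by rewrite pnatr_eq0 -lt0n fact_gt0.
have /(congr1 (fun m => m%:R : R)) := mul_bin_left n k.
rewrite !natrM natrB// => nk.
move: nk f0 k0; set S := k.+1%:R; set c := 'C(n, k)%:R; set c' := 'C(n, k.+1)%:R.
set P := \prod_(_ < _) _; set f := k`!%:R => nk f0 k0.
transitivity (S * (S * c') * (P * (n%:R + b - k%:R)) / (S * f)).
  by rewrite expr2 !mulrA; ring.
by rewrite nk; field; rewrite -/f f0 nat1r k0.
Qed.

(* The polynomial t |-> P_n^(0,b)(2 t - 1). *)
Definition jacobi0 (R : numFieldType) (n : nat) (b : R) : {poly R} :=
  \sum_(k < n.+1) (jacobi_coef n b k)%:P * (('X - 1) ^+ k * 'X ^+ (n - k)).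

(** The operator only couples neighbouring products of the same total degree. The truncated
    predecessors are harmless: their coefficients vanish at k = 0 or m = 0. *)
Lemma jacobi_op_basis (R : numFieldType) (b : R) (k m : nat) :
  let A : {poly R} := 'X - 1 in
  let f := A ^+ k * 'X ^+ m in
  A * 'X * f^`()^`() + ((b + 1)%:P * A + 'X) * f^`() =
    (k%:R ^+ 2)%:P * (A ^+ k.-1 * 'X ^+ m.+1)
    + (2 * k%:R * m%:R + (b + 1) * k%:R + m%:R)%:P * f
    + (m%:R * (m%:R + b))%:P * (A ^+ k.+1 * 'X ^+ m.-1).
Proof.
move=> A f.
have dA : A^`() = 1 by rewrite /A derivB derivX derivC subr0.
rewrite /f; move: A dA {f} => A dA.
rewrite !(derivM, derivD, deriv_exp, derivX, dA, derivMn, derivC).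
rewrite !(rmorphD, rmorphM, rmorphXn, rmorph_nat, polyC1) /=.
case: k => [|[|k]]; case: m => [|[|m]];
  rewrite /= ?mulr0n ?deriv0 ?derivC ?exprS ?expr0; try ring.
Qed.

Lemma jacobi0_ode (R : numFieldType) (n : nat) (b : R) :
  let Q := jacobi0 n b in
  ('X - 1) * 'X * Q^`()^`() + ((b + 1)%:P * ('X - 1) + 'X) * Q^`() =
    (n%:R * (n%:R + b + 1))%:P * Q.
Proof.
move=> Q.
pose A : {poly R} := 'X - 1.
pose c := jacobi_coef n b.
pose f (k : nat) : {poly R} := A ^+ k * 'X ^+ (n - k).
have c_last : c n.+1 = 0 by rewrite /c /jacobi_coef bin_small// mul0r.
have -> : 'X - 1 = A by [].
transitivity (\sum_(k < n.+1) (c k)%:P * (A * 'X * (f k)^`()^`() +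
   ((b + 1)%:P * A + 'X) * (f k)^`())).
  rewrite /Q /jacobi0 !raddf_sum !mulr_sumr -big_split/=; apply: eq_bigr => k _.
  rewrite -/A -/c -/(f k) !(derivM _%:P, derivC, mul0r, add0r).
  by ring.
(* [u k] and [w k.+1] are the outer terms produced by [f k]. Shifting the index brings all
   contributions to the same [f k], where they add up to n (n + b + 1). *)
pose u (k : nat) : {poly R} :=
  (k%:R ^+ 2 * c k)%:P * (A ^+ k.-1 * 'X ^+ (n - k).+1).
pose w (k : nat) : {poly R} := (k%:R ^+ 2 * c k)%:P * f k.
have shift (g : nat -> {poly R}) : g 0 = 0 -> g n.+1 = 0 ->
    \sum_(k < n.+1) g k = \sum_(k < n.+1) g k.+1.
  move=> g0 gn; transitivity (\sum_(k < n.+2) g k).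
    by rewrite [RHS]big_ord_recr/= gn addr0.
  by rewrite big_ord_recl g0 add0r.
transitivity (\sum_(k < n.+1) u k + \sum_(k < n.+1)
   ((2 * k%:R * (n - k)%:R + (b + 1) * k%:R + (n - k)%:R) * c k)%:P * f k
   + \sum_(k < n.+1) w k.+1).
  rewrite -!big_split/=; apply: eq_bigr => -[k] /= kn _.
  rewrite jacobi_op_basis 2!mulrDr !mulrA -!polyCM ![c k * _]mulrC -!mulrA.
  congr (_ + _ + _); first by rewrite /u expr2 -mulrA.
  rewrite /w /c jacobi_coefS // /f subnS natrB //.
  by congr (_%:P * _); ring.
rewrite shift; last 2 first.
- by rewrite /u expr0n mul0r mul0r.
- by rewrite /u c_last mulr0 mul0r.
rewrite -(shift w); last 2 first.
- by rewrite /w expr0n mul0r mul0r.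
- by rewrite /w c_last mulr0 mul0r.
rewrite -!big_split/= /Q /jacobi0 mulr_sumr; apply: eq_bigr => -[k] /= kn _.
have -> : u k.+1 = ((n%:R - k%:R) * (n%:R + b - k%:R) * c k)%:P * f k.
  rewrite /u /c jacobi_coefS // /f.
  case: (ltnP k n) => [/subnSK -> //|nk].
  have -> : k = n by apply/eqP; rewrite eqn_leq nk -ltnS kn.
  by rewrite subrr !mul0r.
rewrite /w -/c -/A -/(f k) -!mulrDl -!polyCD mulrA -polyCM; congr (_%:P * _).
by rewrite natrB//; ring.
Qed.

Lemma horner1_jacobi0 (R : numFieldType) (n : nat) (b : R) :
  (jacobi0 n b).[1] = 1.
Proof.
rewrite /jacobi0 horner_sum big_ord_recl big1 => [|k _]; last first.
  by rewrite /= !hornerM !horner_exp !hornerE subrr exprS mul0r /= mulr0 mul0r.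
rewrite addr0 /= expr0 mul1r subn0 hornerM hornerC hornerXn expr1n mulr1.
by rewrite /jacobi_coef /gbinom bin0 big_ord0 fact0 mul1r divr1.
Qed.

Lemma size_jacobi0 (R : numFieldType) (n : nat) (b : R) :
  (size (jacobi0 n b) <= n.+1)%N.
Proof.
rewrite /jacobi0; apply: (leq_trans (size_sum _ _ _)).
apply/bigmax_leqP => -[k] /= kn _.
rewrite mul_polyC; apply: (leq_trans (size_scale_leq _ _)).
apply: (leq_trans (size_polyMleq _ _)).
by rewrite size_polyXn -polyC1 size_exp_XsubC addnS /= addSn subnKC.
Qed.

(* The Jacobi operator is the self-adjoint form t^-b (t^(b+1) (t-1) p')'. *)
Lemma jacobi_op_selfadjoint (R : numFieldType) (b : R) (p q : {poly R}) :
  0 <= b ->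
  let L (f : {poly R}) :=
    ('X - 1) * 'X * f^`()^`() + ((b + 1)%:P * ('X - 1) + 'X) * f^`() in
  moment (b + 1) (L p * q - p * L q) = 0.
Proof.
(* [w] is X - 1 times a Wronskian; t^(b+1) w vanishes at both 0 and 1. *)
move=> b0 L; pose w := ('X - 1) * (p^`() * q - p * q^`()).
have -> : L p * q - p * L q = (b + 1)%:P * w + 'X * w^`().
  rewrite /L /w !(derivM, derivB, derivX, derivC) subr0.
  by ring.
by rewrite moment_euler ?ltr_wpDl// /w !hornerE subrr mul0r.
Qed.

(** Self-adjointness tested on X^j links the moments of Q X^j and Q X^(j-1). The eigenvalues j (j +
    b + 1) and n (n + b + 1) differ for j < n, so induction on j kills all these moments. *)
Lemma jacobi0_orthogonal (R : numFieldType) (n : nat) (b : R) (p : {poly R}) :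
  0 <= b -> (size p <= n)%N -> moment (b + 1) (jacobi0 n b * p) = 0.
Proof.
move=> b0 pn.
have a0 : 0 < b + 1 by rewrite ltr_wpDl.
pose Q := jacobi0 n b.
pose J := moment (b + 1).
have step j : (n%:R * (n%:R + b + 1) - j%:R * (j%:R + b + 1)) * J (Q * 'X^j) +
    j%:R * (j%:R + b) * J (Q * 'X^(j.-1)) = 0.
  rewrite -[RHS](jacobi_op_selfadjoint Q ('X^j) b0) jacobi0_ode -!momentZ -momentD.
  have LX : ('X - 1) * 'X * ('X^j)^`()^`() +
      ((b + 1)%:P * ('X - 1) + 'X) * ('X^j)^`() =
      (j%:R * (j%:R + b + 1))%:P * 'X^j - (j%:R * (j%:R + b))%:P * 'X^(j.-1).
    rewrite !(derivXn, derivMn) !(rmorphD, rmorphM, rmorph_nat, polyC1).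
    by case: j => [|[|j]]; rewrite /= ?exprS ?expr0; ring.
  by rewrite LX; congr (moment _ _); rewrite polyCB -/Q; ring.
have Xj j : (j < n)%N -> J (Q * 'X^j) = 0.
  elim: j => [|j IHj] jn.
    have /eqP := step 0; rewrite !mul0r addr0 subr0 mulf_eq0 => /orP[|/eqP//].
    by rewrite mulf_eq0 !gt_eqF ?ltr0n// -addrA ltr_wpDl.
  have /eqP := step j.+1; rewrite [_.-1]/= IHj ?(ltnW jn)// mulr0 addr0 mulf_eq0.
  move=> /orP[|/eqP//].
  rewrite subr_eq0 gt_eqF// ltr_pM ?ltr_nat ?ler0n //.
    by rewrite !addr_ge0.
  by rewrite !ltrD2r ltr_nat.
have J0 : J 0 = 0 by rewrite -(mul0r 0) -polyC0 /J momentZ mul0r.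
rewrite -/J -[p]coefK poly_def mulr_sumr (big_morph J (@momentD _ _) J0).
rewrite big1// => -[j] /= jp _; rewrite -mul_polyC mulrCA /J momentZ.
by rewrite -/J Xj ?mulr0// (leq_trans jp).
Qed.

(** * The bound for alpha = 0 *)

Lemma jacobi0_sqr_le1 (R : realType) (n : nat) (b t : R) :
  0 <= b -> 0 < t <= 1 -> t `^ b * (jacobi0 n b).[t] ^+ 2 <= 1.
Proof.
move=> b0 /andP[t0 t1].
set Q := jacobi0 n b.
have a0 : 0 < b + 1 by rewrite ltr_wpDl.
pose e := euler_inv (b + 1) (Q * ((-2)%:P * Q^`())).
have eE : (b + 1)%:P * e + 'X * e^`() = Q * ((-2)%:P * Q^`()).
  exact: euler_invK.
(* This is h(1) = 0: Q is orthogonal to Q', of degree below n. *)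
have e1 : e.[1] = 0.
  apply: jacobi0_orthogonal => //; rewrite mul_polyC.
  apply: (leq_trans (size_scale_leq _ _)).
  have [->|Q0] := eqVneq Q 0; first by rewrite deriv0 size_poly0.
  by rewrite -ltnS (leq_trans (lt_size_deriv Q0)) ?size_jacobi0.
pose l : R := n%:R * (n%:R + b + 1).
(* t^(b+1) [kap] is l h - t^(b+1) (1 - t) Q'^2. *)
pose kap := l%:P * e - (1 - 'X) * Q^`() ^+ 2.
have kapE : (b + 1)%:P * kap + 'X * kap^`() =
    Q^`() ^+ 2 * ((b + 1)%:P - (b + 2)%:P * 'X).
  have -> : (b + 1)%:P * kap + 'X * kap^`() =
      l%:P * ((b + 1)%:P * e + 'X * e^`())
      - (b + 1)%:P * (1 - 'X) * Q^`() ^+ 2 + 'X * Q^`() ^+ 2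
      + 2 * Q^`() * (('X - 1) * 'X * Q^`()^`()).
    rewrite /kap expr2 !(derivM, derivB, derivX, derivC); ring.
  have := jacobi0_ode n b; rewrite -/Q => /= ode.
  have -> : ('X - 1) * 'X * Q^`()^`() =
      l%:P * Q - ((b + 1)%:P * ('X - 1) + 'X) * Q^`().
    by rewrite -ode addrK.
  by rewrite eE !polyCD; ring.
have kapE_ s : (b + 1) * kap.[s] + s * kap^`().[s] =
    Q^`().[s] ^+ 2 * ((b + 1) - (b + 2) * s).
  have := congr1 (horner^~ s) kapE.
  by rewrite !hornerE.
have kapH (s : R) : kap.[s] = l * e.[s] - (1 - s) * Q^`().[s] ^+ 2.
  by rewrite /kap !hornerE /=; ring.
have kap1 : kap.[1] = 0 by rewrite kapH e1 subrr mul0r mulr0 subrr.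
have kap_ge0 (s : R) : 0 < s <= 1 -> 0 <= kap.[s].
  move=> /andP[s0 s1].
  (* The derivative changes sign once, at (b + 1) / (b + 2): before it t^(b+1) [kap] grows from 0,
     after it it decreases to 0. *)
  have [sb|/ltW bs] := lerP ((b + 2) * s) (b + 1).
    apply: (@euler_ge0 _ (b + 1) s) => // [r /andP[r0 rs]|]; last by rewrite s0/=.
    rewrite kapE_ mulr_ge0 ?sqr_ge0// subr_ge0 (le_trans _ sb)//.
    by rewrite ler_pM2l// ltr_wpDl.
  have : s `^ (b + 1) * (- kap).[s] <= 1 `^ (b + 1) * (- kap).[1].
    apply: powR_mul_horner_le => // r /andP[sr r1].
    rewrite derivN !hornerN !mulrN -opprD kapE_ oppr_ge0 mulr_ge0_le0 ?sqr_ge0//.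
    by rewrite subr_le0 (le_trans bs)// ler_pM2l// ltr_wpDl.
  rewrite !hornerN kap1 oppr0 mulr0.
  by rewrite mulrN oppr_le0 pmulr_rge0 ?powR_gt0.
have e_ge0 (s : R) : 0 < s <= 1 -> 0 <= e.[s].
  (* For n = 0, l = 0 and [kap] says nothing about e, but Q is constant and e = 0. *)
  move=> s01; case: (posnP n) => [n0|n_gt0].
    have dQ : Q^`() = 0.
      have /size1_polyC -> : (size Q <= 1)%N.
        by rewrite -[1%N]/(0.+1) -n0 size_jacobi0.
      by rewrite derivC.
    by rewrite /e dQ !mulr0 /euler_inv size_poly0 poly_def big_ord0 horner0.
  have l0 : 0 < l by rewrite mulr_gt0 ?ltr0n// -addrA ltr_wpDl.
  have := kap_ge0 s s01; rewrite kapH subr_ge0 => le_e.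
  rewrite -(pmulr_rge0 _ l0) (le_trans _ le_e)// mulr_ge0 ?sqr_ge0//.
  by rewrite subr_ge0; case/andP: s01.
pose p := Q ^+ 2 + 'X * e.
have pE : b%:P * p + 'X * p^`() = b%:P * Q ^+ 2.
  have -> : b%:P * p + 'X * p^`() = b%:P * Q ^+ 2 + 2 * 'X * Q * Q^`()
      + 'X * ((b + 1)%:P * e + 'X * e^`()).
    by rewrite /p expr2 !(derivM, derivD, derivX) polyCD; ring.
  by rewrite eE; ring.
have pE_ s : b * p.[s] + s * p^`().[s] = b * Q.[s] ^+ 2.
  by have := congr1 (horner^~ s) pE; rewrite !hornerE.
have : t `^ b * p.[t] <= 1 `^ b * p.[1].
  by apply: powR_mul_horner_le => // s _; rewrite pE_ mulr_ge0 ?sqr_ge0.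
have pH (s : R) : p.[s] = Q.[s] ^+ 2 + s * e.[s].
  by rewrite /p !hornerE /=; ring.
rewrite powR1 mul1r !pH e1 mulr0 addr0 horner1_jacobi0 expr1n.
apply: le_trans; rewrite ler_wpM2l ?powR_ge0// lerDl.
by rewrite mulr_ge0 ?(ltW t0)// e_ge0// t0.
Qed.

Lemma jacobi0_le1 (R : realType) (n : nat) (b t : R) :
  0 <= b -> 0 < t <= 1 -> t `^ (b / 2) * `|(jacobi0 n b).[t]| <= 1.
Proof.
move=> b0 t01; rewrite -(@ler_pXn2r _ 2) ?nnegrE ?mulr_ge0 ?powR_ge0//.
rewrite exprMn expr1n -normrX ger0_norm ?sqr_ge0//.
rewrite -(powR_mulrn _ (powR_ge0 _ _)) -powRrM divfK ?pnatr_eq0//.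
exact: jacobi0_sqr_le1.
Qed.

(** * Averaging: from alpha = 0 to alpha >= 0 *)

Lemma pochhammer1 (F : fieldType) (k : nat) : pochhammer (1 : F) k = k`!%:R.
Proof.
rewrite /pochhammer; elim: k => [|k IHk]; first by rewrite big_ord0.
by rewrite big_ord_recr/= IHk factS natrM mulrC nat1r.
Qed.

(* The weights k! / (a + 1)_k are the moments of the law a (1 - s)^(a-1) ds on
   [0, 1], and of the point mass at 1 when a = 0. *)
Lemma beta_mean_norm_le (R : realType) (a C : R) (m : nat) (c : nat -> R) :
  0 <= a -> (forall s, 0 <= s <= 1 -> `|\sum_(k < m) c k * s ^+ k| <= C) ->
  `|\sum_(k < m) k`!%:R / pochhammer (a + 1) k * c k| <= C.
Proof.
rewrite le_eqVlt => /orP[/eqP <-|a0] cC.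
  have := cC 1; rewrite ler01 lexx => /(_ isT); congr (`|_| <= _).
  apply: eq_bigr => -[k] /= _ _; rewrite expr1n mulr1.
  by rewrite add0r pochhammer1 divff ?mul1r// pnatr_eq0 -lt0n fact_gt0.
(* t^a [E k] is the integral of a s^(a-1) (1 - s)^k over [0, t]; the recursion is integration by
   parts. The variable s of the law is reflected to 1 - s. *)
pose E := fix E k : {poly R} := if k is k'.+1 then
  (a / (a + k%:R))%:P * (1 - 'X) ^+ k + (k%:R / (a + k%:R))%:P * E k' else 1.
have ES k : E k.+1 = (a / (a + k.+1%:R))%:P * (1 - 'X) ^+ k.+1
    + (k.+1%:R / (a + k.+1%:R))%:P * E k by [].
have ak k : a + k%:R != 0 by rewrite gt_eqF// ltr_wpDr.
have EE k : a%:P * E k + 'X * (E k)^`() = a%:P * (1 - 'X) ^+ k.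
  elim: k => [|k IHk]; first by rewrite /= derivC mulr0 addr0.
  pose r := a / (a + k.+1%:R); pose q := k.+1%:R / (a + k.+1%:R).
  have rq : r%:P + q%:P = 1 :> {poly R}.
    by rewrite -polyCD -mulrDl divff.
  have rqE : r%:P * k.+1%:R = q%:P * a%:P :> {poly R}.
    by rewrite -polyC_natr -!polyCM /r /q; congr (_%:P); ring.
  rewrite ES -/r -/q derivD !derivM !derivC
    deriv_exp derivB derivX derivC /= -mulr_natr.
  transitivity (r%:P * a%:P * (1 - 'X) ^+ k.+1
      - (r%:P * k.+1%:R) * 'X * (1 - 'X) ^+ k
      + q%:P * (a%:P * E k + 'X * (E k)^`())); first by ring.
  rewrite IHk rqE exprS -[RHS]mul1r -[X in _ = X * _]rq.
  by ring.
have E1 k : (E k).[1] = k`!%:R / pochhammer (a + 1) k.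
  elim: k => [|k IHk].
    by rewrite hornerC /pochhammer big_ord0 fact0 divr1.
  rewrite ES hornerD !hornerM !hornerC horner_exp hornerD hornerN hornerX hornerC.
  rewrite subrr exprS mul0r mulr0 add0r IHk /pochhammer big_ord_recr/= factS natrM.
  by rewrite -addrA nat1r mulf_div mulrC [X in _ / X]mulrC mulrC.
pose e : {poly R} := \sum_(k < m) (c k)%:P * E k.
have eE s : a * e.[s] + s * e^`().[s] = a * \sum_(k < m) c k * (1 - s) ^+ k.
  rewrite /e raddf_sum !horner_sum !mulr_sumr -big_split/=.
  apply: eq_bigr => k _.
  have := congr1 (horner^~ s) (EE k).
  rewrite hornerD !hornerM hornerX !hornerC horner_exp hornerD hornerN hornerX hornerC.
  rewrite derivM derivC mul0r add0r !hornerM !hornerC => EEs.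
  transitivity (c k * (a * (E k).[s] + s * (E k)^`().[s])); first by ring.
  by rewrite EEs; ring.
have e1 : e.[1] = \sum_(k < m) k`!%:R / pochhammer (a + 1) k * c k.
  rewrite /e horner_sum; apply: eq_bigr => k _.
  by rewrite hornerM hornerC E1 mulrC.
have H s : 0 < s <= 1 -> `|\sum_(k < m) c k * (1 - s) ^+ k| <= C.
  by move=> /andP[/ltW s0 s1]; rewrite cC// subr_ge0 s1 lerBlDr lerDl.
(* Both C + e and C - e are nonnegative at 1, since the pointwise bound makes their Euler images
   nonnegative on (0, 1]. *)
rewrite -e1 ler_norml -subr_ge0 opprK -[X in _ && X]subr_ge0; apply/andP; split.
  suff : 0 <= (e + C%:P).[1] by rewrite !hornerE.
  apply: (@euler_ge0 _ a 1) => //; last by rewrite ltr01/=.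
  move=> s s01; rewrite derivD derivC addr0 hornerD hornerC mulrDr addrAC eE.
  rewrite -mulrDr.
  by rewrite mulr_ge0 ?(ltW a0)// -lerBlDr sub0r;
    have := H s s01; rewrite ler_norml => /andP[].
suff : 0 <= (C%:P - e).[1] by rewrite !hornerE.
apply: (@euler_ge0 _ a 1) => //; last by rewrite ltr01/=.
move=> s s01; rewrite derivB derivC sub0r hornerD !hornerN hornerC mulrBr.
rewrite mulrN -addrA -opprD eE -mulrBr.
by rewrite mulr_ge0 ?(ltW a0)// subr_ge0;
    have := H s s01; rewrite ler_norml => /andP[].
Qed.

Lemma jacobi_le1 (R : realType) (n : nat) (a b t : R) :
  0 <= a -> 0 <= b -> 0 < t <= 1 ->
  t `^ (b / 2) * `|\sum_(k < n.+1) k`!%:R / pochhammer (a + 1) k *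
    (jacobi_coef n b k * (t - 1) ^+ k * t ^+ (n - k))| <= 1.
Proof.
move=> a0 b0 /andP[t0 t1].
rewrite -[X in X * _](ger0_norm (powR_ge0 _ _)) -normrM mulr_sumr.
under eq_bigr do rewrite mulrCA.
apply: (@beta_mean_norm_le _ a 1 n.+1 (fun k => t `^ (b / 2) *
  (jacobi_coef n b k * (t - 1) ^+ k * t ^+ (n - k)))) => // s /andP[s0 s1].
(* t / D is the c_s of the averaging: 1 - D / t = s (1 - 1 / t). *)
pose D := t + s * (1 - t).
have D0 : 0 < D by rewrite ltr_wpDr// mulr_ge0// subr_ge0.
have D1 : D <= 1 by rewrite /D -[leRHS](subrKC t) lerD2l ler_piMl// subr_ge0.
have -> : \sum_(k < n.+1) t `^ (b / 2) *
    (jacobi_coef n b k * (t - 1) ^+ k * t ^+ (n - k)) * s ^+ k =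
    t `^ (b / 2) * (D ^+ n * (jacobi0 n b).[t / D]).
  rewrite /jacobi0 horner_sum !mulr_sumr; apply: eq_bigr => -[k] /= kn _.
  have -> : D ^+ n = D ^+ k * D ^+ (n - k) by rewrite -exprD subnKC// -ltnS.
  rewrite !hornerM horner_exp hornerXn hornerD hornerN hornerX !hornerC.
  have -> : t / D - 1 = s * (t - 1) / D.
    by rewrite /D; field; rewrite -/D; exact: lt0r_neq0.
  rewrite !exprMn !exprVn.
  by field; rewrite !expf_neq0 ?gt_eqF.
(* Split t^(b/2) as (t / D)^(b/2) D^(b/2): the first factor goes with Q(t / D), and D^(b/2) D^n <=
   1. *)
rewrite -{1}(divfK (lt0r_neq0 D0) t) powRM ?divr_ge0 ?(ltW D0) ?(ltW t0)//.
rewrite !normrM !(ger0_norm (powR_ge0 _ _)) ger0_norm ?exprn_ge0 ?(ltW D0)//.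
rewrite [X in _ * X]mulrC mulrACA mulr_ile1 ?mulr_ge0 ?powR_ge0 ?exprn_ge0//.
- exact: ltW.
- by rewrite jacobi0_le1// divr_gt0//= ler_pdivrMr// mul1r /D lerDl mulr_ge0// subr_ge0.
- rewrite mulr_ile1 ?powR_ge0 ?exprn_ge0 ?exprn_ile1 ?(ltW D0)//.
  by rewrite -[leRHS](powRr0 D) ger_powR ?D0// divr_ge0.
Qed.

(** * Reduction of both families to one sum *)

Lemma prod_falling (F : fieldType) (z : F) (m k : nat) :
  \prod_(i < m + k) ((m + k)%:R + z - i%:R) =
  (\prod_(i < m) ((m + k)%:R + z - i%:R)) * pochhammer (z + 1) k.
Proof.
rewrite big_split_ord/=; congr (_ * _).
rewrite /pochhammer (reindex_inj rev_ord_inj)/=; apply: eq_bigr => -[i] /= ik _.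
by rewrite !natrD (natrB _ ik) -natr1; ring.
Qed.

(** binom(n + a, n - k) = binom(n + a, n) C(n, k) k! / (a + 1)_k, so a enters the normalized sum
    only through the averaging weights. *)
Lemma jacobiE (R : numFieldType) (n : nat) (a b x : R) : 0 <= a ->
  jacobi n a b x = gbinom (n%:R + a) n *
    \sum_(k < n.+1) k`!%:R / pochhammer (a + 1) k *
      (jacobi_coef n b k * ((1 + x) / 2 - 1) ^+ k * ((1 + x) / 2) ^+ (n - k)).
Proof.
move=> a0; rewrite /jacobi mulr_sumr; apply: eq_bigr => -[k] /= kn _.
have -> : (x - 1) / 2 = (1 + x) / 2 - 1 by field.
rewrite [x + 1]addrC /jacobi_coef.
have fne0 j : j`!%:R != 0 :> R by rewrite pnatr_eq0 -lt0n fact_gt0.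
have pk0 : pochhammer (a + 1) k != 0.
  by apply/prodf_neq0 => i _; rewrite gt_eqF// ltr_wpDr// ltr_wpDl.
suff -> : gbinom (n%:R + a) (n - k) =
    gbinom (n%:R + a) n * (k`!%:R / pochhammer (a + 1) k) * 'C(n, k)%:R by ring.
have := bin_fact (ltnSE kn); move=> /(congr1 (fun m => m%:R : R)).
rewrite !natrM /gbinom => <-.
have /= := prod_falling a (n - k) k; rewrite subnK; last by rewrite -ltnS.
move=> ->.
have C0 : 'C(n, k)%:R != 0 :> R by rewrite pnatr_eq0 -lt0n bin_gt0 -ltnS.
move: (fne0 k) (fne0 (n - k)%N) pk0 C0.
move: (\prod_(_ < _) _) (pochhammer _ _) k`!%:R (n - k)`!%:R 'C(n, k)%:R.
move=> P p f g c f0 g0 p0 c0; field.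
by rewrite p0 f0 g0 c0.
Qed.

(** With Jacobi parameter x - n, the upper argument n + (x - n) is x, which matches (-x)_k up to
    sign; c^n clears the powers of 1/c. *)
Lemma meixnerE (R : numFieldType) (n : nat) (x a c : R) : 0 <= a -> c != 0 ->
  c ^+ n * meixner n x (a + 1) c =
    \sum_(k < n.+1) k`!%:R / pochhammer (a + 1) k *
      (jacobi_coef n (x - n%:R) k * (c - 1) ^+ k * c ^+ (n - k)).
Proof.
move=> a0 c0; rewrite /meixner mulr_sumr; apply: eq_bigr => -[k] /= kn _.
have f0 : k`!%:R != 0 :> R by rewrite pnatr_eq0 -lt0n fact_gt0.
have pk0 : pochhammer (a + 1) k != 0.
  by apply/prodf_neq0 => i _; rewrite gt_eqF// ltr_wpDr// ltr_wpDl.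
have pochN (z : R) j :
    pochhammer (- z) j = (-1) ^+ j * \prod_(i < j) (z - i%:R).
  rewrite /pochhammer; elim: j => [|j IHj]; first by rewrite !big_ord0 mulr1.
  by rewrite !big_ord_recr/= IHj exprS; ring.
have nk : \prod_(i < k) (n%:R - i%:R) = k`!%:R * 'C(n, k)%:R :> R.
  have := ltnSE kn; elim: (k) => [|j IHj] jn; first by rewrite big_ord0 bin0 mulr1.
  rewrite big_ord_recr/= IHj ?(ltnW jn)// factS natrM -natrB ?(ltnW jn)//.
  have /(congr1 (fun i => i%:R : R)) := mul_bin_left n j; rewrite !natrM => e.
  by rewrite mulrC mulrCA -e; ring.
rewrite !pochN nk /jacobi_coef /gbinom [n%:R + _]addrC subrK.
have -> : c ^+ n = c ^+ k * c ^+ (n - k) by rewrite -exprD subnKC// -ltnS.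
have -> : (c - 1) ^+ k = (-1) ^+ k * (-1) ^+ k * c ^+ k * (1 - c^-1) ^+ k.
  by rewrite -!exprMn; congr (_ ^+ _); field.
by field; rewrite f0 pk0.
Qed.

Lemma jacobi_le1_0 (R : realType) (n : nat) (a b : R) : 0 <= a ->
  0 `^ (b / 2) * `|\sum_(k < n.+1) k`!%:R / pochhammer (a + 1) k *
    (jacobi_coef n b k * (0 - 1) ^+ k * 0 ^+ (n - k))| <= 1.
Proof.
(* 0^(b/2) is 0 unless b = 0, where it is 1; then only k = n survives and the averaged function is
   (-s)^n. *)
move=> a0; have [->|b0] := eqVneq b 0; last first.
  by rewrite powR0 ?mul0r ?ler01// mulf_neq0// invr_neq0// pnatr_eq0.
rewrite mul0r powRr0 mul1r.
apply: (@beta_mean_norm_le R a 1 n.+1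
  (fun k => jacobi_coef n 0 k * (0 - 1) ^+ k * 0 ^+ (n - k))) => // s /andP[s0 s1].
rewrite big_ord_recr/= big1 ?add0r => [|[k] /= kn _]; last first.
  by rewrite expr0n subn_eq0 leqNgt kn !(mulr0, mul0r).
have -> : jacobi_coef n 0 n = 1 :> R.
  have := prod_falling (0 : R) 0 n.
  rewrite big_ord0 mul1r add0r pochhammer1 add0n /jacobi_coef /gbinom binn => ->.
  by rewrite mul1r divff// pnatr_eq0 -lt0n fact_gt0.
rewrite subnn expr0 mulr1 mul1r -exprMn mulN1r normrX normrN.
by rewrite exprn_ile1 ?normr_ge0// ger0_norm.
Qed.

Theorem theorem5p1 (R : realType) :
  (forall (n : nat) (alpha beta : R),
     0 <= beta -> beta - (Num.floor beta)%:~R <= alpha ->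
     forall x : R, -1 <= x <= 1 ->
       ((1 + x) / 2) `^ (beta / 2) * `|jacobi n alpha beta x|
         <= gbinom (n%:R + alpha) n)
  /\
  (forall (n : nat) (x c beta : R),
     n%:R <= x -> 0 < c < 1 -> x - (Num.floor x)%:~R + 1 <= beta ->
       c `^ ((n%:R + x) / 2) * `|meixner n x beta c| <= 1).
Proof.
(* Fractional parts are nonnegative, which gives alpha >= 0 in (a) and beta - 1 >= 0 in (b). *)
have frac_ge0 (y : R) : 0 <= y - (Num.floor y)%:~R by rewrite subr_ge0 floor_le.
split=> [n a b b0 /(le_trans (frac_ge0 _)) a0 x /andP[xN1 x1]|].
  have g0 : 0 <= gbinom (n%:R + a) n.
    rewrite /gbinom divr_ge0// prodr_ge0// => i _.
    by rewrite addrAC -natrB ?(ltnW (ltn_ord i))// addr_ge0.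
  rewrite jacobiE// normrM (ger0_norm g0) mulrCA ler_piMr//.
  have [x0|x0] := leP x (-1).
    have -> : (1 + x) / 2 = 0 by lra.
    exact: jacobi_le1_0.
  by apply: jacobi_le1 => //; lra.
move=> n x c b nx /andP[c0 c1] xb.
have a0 : 0 <= b - 1 by have := frac_ge0 x; lra.
(* c^n goes into the polynomial form, leaving the weight c^((x-n)/2) of Jacobi parameter x - n >=
   0. *)
have -> : (n%:R + x) / 2 = (x - n%:R) / 2 + n%:R by field.
rewrite powRD ?(gt_eqF c0) ?implybT// powR_mulrn ?(ltW c0)// -mulrA.
rewrite -[X in X * `|_|]ger0_norm ?exprn_ge0 ?(ltW c0)// -normrM.
have -> : b = b - 1 + 1 by rewrite subrK.
rewrite meixnerE// ?gt_eqF//.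
by apply: jacobi_le1 => //; [rewrite subr_ge0 | rewrite c0 ltW].
Qed.
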